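(* Let $X$, $Y$ be Hilbert spaces, let $A:D(A)\subset X\to X$ be the (closed, densely defined) generator of a strongly continuous semigroup on $X$, let $C\in L(X,Y)$ and $Q=C^*C$. Assume: (i) $A$ satisfies the spectral decomposition assumption, with induced decomposition $X=X_u\oplus X_s$ and corresponding restrictions $A_u$, $A_s$ of $A$ to $X_u$, $X_s$, and $A_s$ is exponentially stable (i.e. generates an exponentially stable semigroup on $X_s$); (ii) $\sigma^+(A)=\sigma(A)\cap\{s\in\mathbb{C}:\operatorname{Re}s\ge 0\}$ consists of finitely many eigenvalues of finite order; (iii) $X_u$ is orthogonal to $X_s$, i.e. $\langle x_u,x_s\rangle=0$ for all $x_u\in X_u$, $x_s\in X_s$; (iv) $(A,C)$ is exponentially detectable. Then there are a positive and self-adjoint operator $P\in L(X,X)$ and a constant $m>0$ such that $$\langle (Q-A^*P-PA)x,x\rangle\ge m\|x\|^2\qquad\text{for all }x\in D(A).$$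
   Context: $\langle\cdot,\cdot\rangle$ and $\|\cdot\|$ are the inner product and norm of $X$. $L(V,W)$ denotes bounded linear operators from $V$ to $W$. Hilbert spaces are identified with their duals via the Riesz isomorphism. For $x\in D(A)$ the expression $\langle (Q-A^*P-PA)x,x\rangle$ is understood as $\langle Qx,x\rangle-\langle Px,Ax\rangle-\langle PAx,x\rangle$. A self-adjoint $P\in L(X,X)$ is positive if $\langle Px,x\rangle>0$ for all $x\neq 0$. Spectral decomposition assumption: let $\sigma^+(A)=\sigma(A)\cap\{s\in\mathbb{C}:\operatorname{Re}s\ge0\}$ and $\sigma^-(A)=\sigma(A)\cap\{s\in\mathbb{C}:\operatorname{Re}s<0\}$. $A$ satisfies the spectral decomposition assumption if $\sigma^+(A)$ is bounded and separated from $\sigma^-(A)$ in such a way that a rectifiable, simple, closed curve $\Gamma$ can be drawn so as to enclose an open set containing $\sigma^+(A)$ in its interior and $\sigma^-(A)$ in its exterior. In this case the spectral projection is $$\mathcal{P}x=\frac{1}{2\pi i}\int_\Gamma (sI-A)^{-1}x\,ds,\quad x\in X$$ ($\Gamma$ traversed once in the positive direction), and $X_u=\mathcal{P}X$, $X_s=(I-\mathcal{P})X$. One has $X_u\subset D(A)$, and with respect to $X=X_u\oplus X_s$ the operator $A$ is block diagonal with blocks $A_u$ (bounded) and $A_s$, the restrictions of $A$ to $X_u$ and to $X_s$ (with domain $D(A)\cap X_s$). Eigenvalue of finite order: an isolated eigenvalue of finite algebraic multiplicity; thus under (ii) the space $X_u$ is finite dimensional, spanned by finitely many (generalized) eigenvectors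 of $A$. Exponential detectability: $(A,C)$ is exponentially detectable if there is $L\in L(Y,X)$ such that $A+LC$ generates an exponentially stable semigroup on $X$. A semigroup $(S(t))_{t\ge0}$ is exponentially stable if there are $M\geq 1,\omega>0$ with $\|S(t)\|\le Me^{-\omega t}$ for all $t\ge0$. *)

(* Defs.v *)
From HB Require Import structures.
From mathcomp Require Import all_boot all_order all_algebra.
From mathcomp Require Import sesquilinear.
From mathcomp Require Import complex.
From mathcomp Require Import all_classical all_reals all_analysis.
Import Order.TTheory GRing.Theory Num.Theory.
Import numFieldNormedType.Exports.

Set Implicit Arguments.
Unset Strict Implicit.
Unset Printing Implicit Defensive.

Local Open Scope classical_set_scope.
Local Open Scope ring_scope.
Local Open Scope complex_scope.

(* A complex Hilbert space is a complete normed module X over R[i] with a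
   positive definite sesquilinear form, linear in the first argument, that
   induces the norm of X.  Norms take their values in R[i], so real bounds are
   embedded by %:C; x <= y in R[i] means Im x = Im y and Re x <= Re y. *)
Definition inner_product (R : realType) (X : normedModType R[i])
    (ip : {dot X for Num.conj}) : Prop :=
  forall x : X, ip x x = `|x| ^+ 2.

(* By the Riesz representation theorem the set below is a singleton as soon as
   T is linear and bounded and X is complete. *)
Definition adjoint (R : realType) (X Y : normedModType R[i])
    (ipX : {dot X for Num.conj}) (ipY : {dot Y for Num.conj})
    (T : X -> Y) (y : Y) : X :=
  xget 0 [set z | forall x, ipY (T x) y = ipX x z].

Definition self_adjoint (R : realType) (X : normedModType R[i])
    (ip : {dot X for Num.conj}) (P : X -> X) : Prop :=
  forall x y, ip (P x) y = ip x (P y).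

Definition positive_op (R : realType) (X : normedModType R[i])
    (ip : {dot X for Num.conj}) (P : X -> X) : Prop :=
  forall x, x != 0 -> 0 < ip (P x) x.

(* An unbounded operator is a domain D together with a total function A, whose
   values outside D are irrelevant. *)
Section UnboundedOperators.
Context {R : realType} {X : normedModType R[i]}.
Implicit Types (D : set X) (A : X -> X).

Definition linear_operator D A : Prop :=
  D 0 /\ forall (a : R[i]) x y, D x -> D y ->
    D (a *: x + y) /\ A (a *: x + y) = a *: A x + A y.

Definition closed_operator D A : Prop :=
  closed [set p : X * X | D p.1 /\ A p.1 = p.2].

Definition densely_defined D : Prop := dense D.

Definition resolvent_set D A : set R[i] :=
  [set s | exists T : {linear X -> X},
    [/\ continuous T,
        (forall x, D (T x) /\ s *: T x - A (T x) = x) &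
        (forall x, D x -> T (s *: x - A x) = x)]].

Definition spectrum D A : set R[i] := ~` resolvent_set D A.

Definition resolvent D A (s : R[i]) (x : X) : X :=
  xget 0 [set y | D y /\ s *: y - A y = x].

Definition spectrum_plus D A : set R[i] :=
  spectrum D A `&` [set s | 0 <= complex.Re s].

Definition spectrum_minus D A : set R[i] :=
  spectrum D A `&` [set s | complex.Re s < 0].

Definition eigenvalue_of D A (s : R[i]) : Prop :=
  exists x, [/\ D x, x != 0 & A x = s *: x].

(* Semigroups acting on a linear subspace V of X; V = setT is the case of X
   itself.  Only the values S t x with 0 <= t and V x matter. *)
Definition C0_semigroup (V : set X) (S : R -> X -> X) : Prop :=
  [/\ forall t x, 0 <= t -> V x -> V (S t x),
      forall t (a : R[i]) x y, 0 <= t -> V x -> V y ->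
        S t (a *: x + y) = a *: S t x + S t y,
      forall t, 0 <= t ->
        exists M : R, forall x, V x -> `|S t x| <= M%:C * `|x|,
      (forall x, V x -> S 0 x = x) /\
      (forall s t x, 0 <= s -> 0 <= t -> V x -> S (s + t) x = S s (S t x)) &
      forall x, V x -> S t x @[t --> 0^'+] --> x].

Definition generated_by (V : set X) (S : R -> X -> X) D A : Prop :=
  forall x y, V x ->
    ((D x /\ A x = y) <->
     (t%:C)^-1 *: (S t x - x) @[t --> 0^'+] --> y).

Definition exp_stable (V : set X) (S : R -> X -> X) : Prop :=
  exists M w : R, [/\ 1 <= M, 0 < w &
    forall t x, 0 <= t -> V x -> `|S t x| <= (M * expR (- (w * t)))%:C * `|x|].

Definition generates_semigroup (V : set X) D A : Prop :=
  exists S, C0_semigroup V S /\ generated_by V S D A.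

Definition generates_exp_stable (V : set X) D A : Prop :=
  exists S, [/\ C0_semigroup V S, generated_by V S D A & exp_stable V S].

End UnboundedOperators.

Definition exp_detectable (R : realType) (X Y : normedModType R[i])
    (D : set X) (A : X -> X) (C : X -> Y) : Prop :=
  exists L : {linear Y -> X}, continuous L /\
    generates_exp_stable setT D (fun x => A x + L (C x)).

(* Paths are parametrized by [0, 1].  The topology of the complex plane is
   carried by the alias R[i]^o. *)
Section Contours.
Context {R : realType}.
Implicit Type g : R -> R[i]^o.

Definition partition01 (n : nat) (t : nat -> R) : Prop :=
  [/\ t 0%N = 0, t n = 1 & forall i, (i < n)%N -> t i <= t i.+1].

Definition rectifiable g : Prop :=
  exists M : R, forall n t, partition01 n t ->
    \sum_(i < n) `|g (t i.+1) - g (t i)| <= M%:C.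

Definition path_image g : set R[i]^o := g @` `[0, 1].

Definition simple_closed_path g : Prop :=
  [/\ {within `[0, 1], continuous g}, g 0 = g 1 &
      forall s t, 0 <= s < 1 -> 0 <= t < 1 -> g s = g t -> s = t].

(* v is the integral of f along g: the limit of the Riemann-Stieltjes sums as
   the mesh of the tagged partition (t, xi) tends to 0. *)
Definition is_contour_integral (V : normedModType R[i]) g (f : R[i] -> V)
    (v : V) : Prop :=
  forall e : R, 0 < e -> exists2 d : R, 0 < d &
    forall n (t xi : nat -> R), partition01 n t ->
      (forall i, (i < n)%N -> t i <= xi i <= t i.+1 /\ t i.+1 - t i < d) ->
      `|v - \sum_(i < n) (g (t i.+1) - g (t i)) *: f (g (xi i))| < e%:C.

Definition contour_integral (V : normedModType R[i]) g (f : R[i] -> V) : V :=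
  xget 0 [set v | is_contour_integral g f v].

Definition two_pi_i : R[i] := 0 +i* (2 * pi).

(* The interior (exterior) of a simple closed curve is the union of the bounded
   (unbounded) connected components of its complement. *)
Definition path_interior g : set R[i]^o :=
  [set z | ~ path_image g z /\
     bounded_set (connected_component (~` path_image g) z)].

Definition path_exterior g : set R[i]^o :=
  [set z | ~ path_image g z /\
     ~ bounded_set (connected_component (~` path_image g) z)].

(* Simplicity makes the path run once along the curve; the positive direction
   is the one with winding number 1 around interior points. *)
Definition positively_oriented g : Prop :=
  forall z, path_interior g z ->
    contour_integral g (fun s => (s - z)^-1 : R[i]^o) = two_pi_i.

Definition circle_path (a : R[i]) (r : R) : R -> R[i]^o :=
  fun t => a + r%:C * (cos (2 * pi * t) +i* sin (2 * pi * t)).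

End Contours.

Section SpectralDecomposition.
Context {R : realType} {X : normedModType R[i]}.
Implicit Types (D : set X) (A : X -> X) (g : R -> R[i]^o).

Definition spectral_decomposition D A g : Prop :=
  [/\ bounded_set (spectrum_plus D A : set R[i]^o),
      simple_closed_path g /\ rectifiable g,
      positively_oriented g,
      spectrum_plus D A `<=` path_interior g &
      spectrum_minus D A `<=` path_exterior g].

Definition spectral_projection D A g (x : X) : X :=
  two_pi_i^-1 *: contour_integral g (fun s => resolvent D A s x).

Definition unstable_space D A g : set X := range (spectral_projection D A g).

Definition stable_space D A g : set X :=
  range (fun x => x - spectral_projection D A g x).

Definition finite_dimensional (V : set X) : Prop :=
  exists (n : nat) (v : 'I_n -> X), forall x, V x ->
    exists c : 'I_n -> R[i], x = \sum_i c i *: v i.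

(* The algebraic multiplicity of an isolated point a of the spectrum is the
   dimension of the range of the spectral projection along a small circle
   around a; this range does not depend on the radius. *)
Definition eigenvalue_of_finite_order D A (a : R[i]) : Prop :=
  eigenvalue_of D A a /\ exists r : R,
    [/\ 0 < r,
        (forall s : R[i], 0 < `|s - a| <= r%:C -> resolvent_set D A s) &
        finite_dimensional (unstable_space D A (circle_path a r))].

End SpectralDecomposition.

(* Main.v *)
From HB Require Import structures.
Require Import Defs.
From mathcomp Require Import all_boot all_order all_algebra.
From mathcomp Require Import sesquilinear.
From mathcomp Require Import complex.
From mathcomp Require Import all_classical all_reals all_analysis.
From mathcomp Require Import ring lra.
Import Order.TTheory GRing.Theory Num.Theory.
Import numFieldNormedType.Exports.

(* Detectability alone suffices.  Let S be the exponentially stable semigroup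
   generated by A + L C.  The operator P0 = int_0^oo S(t)^* S(t) dt satisfies
   2 Re <P0 x, (A + L C) x> = - |x|^2 on D(A), so that
   - 2 Re <P0 x, A x> >= |x|^2 - 2 c |x| |C x| >= |x|^2 / 2 - 2 c^2 |C x|^2
   with c = |P0| |L|, and P = P0 / (2 c^2) has the required properties.
   No integral is needed: the form of P0 is obtained as the limit, along an
   ultrafilter, of the sums h sum_(n < 4^k) <S(n h) x, S(n h) y> with
   h = 2^-k, and P0 is recovered from its form by Riesz representation. *)

Set Implicit Arguments.
Unset Strict Implicit.
Unset Printing Implicit Defensive.

Local Open Scope classical_set_scope.
Local Open Scope ring_scope.
Local Open Scope complex_scope.

(** * Real part of the inner product and real-valued norm *)

Lemma conjCE (R : realType) (z : R[i]) : Num.conj z = conjc z.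
Proof.
have [->|z0] := eqVneq z 0; first by rewrite rmorph0 conjc0.
by apply: (mulfI z0); rewrite -normCK sqr_normc.
Qed.

Lemma ReZ (R : realType) (a : R) (z : R[i]) :
  complex.Re (a%:C * z) = a * complex.Re z.
Proof. by case: z => u v; simpc. Qed.

Section InnerProduct.
Context (R : realType) (X : normedModType R[i]) (ip : {dot X for Num.conj}).
Hypothesis hip : inner_product ip.

(** Real values put the estimates in an ordered field, within reach of [lra] and [nra]; [ip_rip]
    recovers the complex form. *)
Definition rip (x y : X) : R := complex.Re (ip x y).
Definition rnorm (x : X) : R := complex.Re `|x|.

Lemma rnormE x : `|x| = (rnorm x)%:C.
Proof. exact/esym/RRe_real/normr_real. Qed.

Lemma rnorm_ge0 x : 0 <= rnorm x.
Proof. by rewrite -ler0c -rnormE normr_ge0. Qed.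

Lemma ripC x y : rip x y = rip y x.
Proof. by rewrite /rip (hermC ip x y) expr0 mul1r /= conjCE; case: (ip y x). Qed.

Lemma ripDl x y z : rip (x + y) z = rip x z + rip y z.
Proof. by rewrite /rip linearDl raddfD. Qed.

Lemma ripNl x z : rip (- x) z = - rip x z.
Proof. by rewrite /rip linearNl raddfN. Qed.

Lemma ripZl (a : R) x y : rip (a%:C *: x) y = a * rip x y.
Proof. by rewrite /rip (linearZl_LR ip) /= ReZ. Qed.

(** This is the trace that sesquilinearity leaves on the real part; with it, complex linearity can
    be recovered from real identities. *)
Lemma rip_adjZ (a : R[i]) x y : rip (a *: x) y = rip x (conjc a *: y).
Proof.
by rewrite /rip (linearZl_LR ip) (linearZr_LR ip) /= conjCE conjcK.
Qed.

Lemma rnorm2 x : rnorm x ^+ 2 = rip x x.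
Proof. by rewrite /rip hip rnormE -rmorphXn. Qed.

Lemma rnormZ (a : R) x : rnorm (a%:C *: x) = `|a| * rnorm x.
Proof.
apply: complexI; rewrite -rnormE normrZ rmorphM /= rnormE; congr (_ * _).
by rewrite normc_def /= expr0n addr0 sqrtr_sqr.
Qed.

Lemma rnorm_triangle x y : rnorm (x + y) <= rnorm x + rnorm y.
Proof. by rewrite -lecR rmorphD /= -!rnormE ler_normD. Qed.

Lemma rnormN x : rnorm (- x) = rnorm x.
Proof. by rewrite /rnorm normrN. Qed.

Lemma rnorm_gt0 x : x != 0 -> 0 < rnorm x.
Proof. by move=> x0; rewrite -ltcR -rnormE normr_gt0. Qed.

Lemma ripDr x y z : rip x (y + z) = rip x y + rip x z.
Proof. by rewrite !(ripC x) ripDl. Qed.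

Lemma ripNr x y : rip x (- y) = - rip x y.
Proof. by rewrite !(ripC x) ripNl. Qed.

Lemma ripZr (a : R) x y : rip x (a%:C *: y) = a * rip x y.
Proof. by rewrite !(ripC x) ripZl. Qed.

Lemma ripD2 x y : rnorm (x + y) ^+ 2 = rnorm x ^+ 2 + 2 * rip x y + rnorm y ^+ 2.
Proof. by rewrite !rnorm2 !(ripDl, ripDr) (ripC y x); ring. Qed.

(** The norm already satisfies the triangle inequality; squaring it gives the upper bound, and
    replacing x by -x gives the lower one. *)
Lemma rip_CauchySchwarz x y : `|rip x y| <= rnorm x * rnorm y.
Proof.
have hp u v : rip u v <= rnorm u * rnorm v.
  have := rnorm_triangle u v.
  rewrite -(@ler_pXn2r _ 2) ?nnegrE ?addr_ge0 ?rnorm_ge0 //.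
  rewrite ripD2; lra.
by rewrite ler_norml hp lerNl -ripNl -(rnormN x) hp.
Qed.

Lemma rip_inj y z : (forall x, rip x y = rip x z) -> y = z.
Proof.
move=> h; apply/eqP; rewrite -subr_eq0; apply/eqP.
apply: contrapT => /eqP/rnorm_gt0; apply/negP; rewrite -leNgt.
suff: rnorm (y - z) ^+ 2 = 0 by move/eqP; rewrite sqrf_eq0 => /eqP ->.
by rewrite rnorm2 ripDr ripNr h subrr.
Qed.

(** The form is conjugate linear in its second argument, so multiplying that argument by i turns the
    imaginary part into a real part. *)
Lemma ip_rip x y : ip x y = rip x y +i* rip x ('i *: y).
Proof.
rewrite /rip (linearZr_LR ip) /= conjCE; case: (ip x y) => a b /=.
by congr (_ +i* _); rewrite mul0r sub0r mulN1r opprK.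
Qed.

End InnerProduct.

(** * Riesz representation, operators from forms, and adjoints *)

(* The representing vector is the minimiser of the functional
   [|x|^2 - 2 f x], whose minimising filter is Cauchy by the parallelogram
   law. *)
Lemma riesz_representation (R : realType) (X : completeNormedModType R[i])
    (ip : {dot X for Num.conj}) (hip : inner_product ip) (f : X -> R) (K : R) :
  {morph f : x y / x + y} -> (forall (a : R) x, f (a%:C *: x) = a * f x) ->
  (forall x, `|f x| <= K * rnorm x) ->
  exists z, forall x, f x = rip ip x z.
Proof.
move=> fD fZ fK.
pose J x := rnorm x ^+ 2 - 2 * f x.
have fN x : f (- x) = - f x.
  have := fZ (-1) x; rewrite mulN1r => <-; congr f.
  by rewrite rmorphN1 scaleN1r.
have JD x y : J (x + y) = J x + 2 * rip ip x y + rnorm y ^+ 2 - 2 * f y.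
  by rewrite /J (ripD2 hip) fD; ring.
have Jlb : has_inf (range J).
  split; first by exists (J 0), 0.
  exists (- K ^+ 2) => _ [x _ <-]; rewrite /J.
  have := fK x; rewrite ler_norml => /andP[_ h].
  by have := sqr_ge0 (rnorm x - K); nra.
pose m := inf (range J).
have Jm x : m <= J x by apply: ge_inf; [case: Jlb|exists x].
pose F : set_system X :=
  filter_from [set e : R | 0 < e] (fun e => [set x | J x < m + e]).
have FF : ProperFilter F.
  apply: filter_from_proper.
    apply: filter_from_filter; first by exists 1 => /=.
    move=> a b a0 b0; exists (Num.min a b); first by rewrite /= lt_min a0 b0.
    move=> x /= h; split => /=; apply: (lt_le_trans h);
      by rewrite lerD2l ge_min lexx ?orbT.
  move=> e e0; have [_ [x _ <-] Jx] := inf_adherent e0 Jlb.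
  by exists x.
have Fc : cauchy F.
  apply: cauchy_exP => eps eps0.
  have epsE : eps = (complex.Re eps)%:C by rewrite RRe_real // gtr0_real.
  have e0 : 0 < complex.Re eps by rewrite -ltcR -epsE.
  set e := complex.Re eps in epsE e0.
  (* The midpoint has value at least m, so |x - y|^2 / 2 = J x + J y - 2 J((x + y) / 2) < e^2 / 2
     once both values lie below m + e^2 / 4. *)
  have e20 : 0 < e ^+ 2 / 4 by rewrite divr_gt0 // exprn_gt0.
  have [_ [x _ <-] Jx] := inf_adherent e20 Jlb.
  exists x; exists (e ^+ 2 / 4) => // y /= Jy.
  rewrite -ball_normE /= epsE rnormE ltcR.
  rewrite -(@ltr_pXn2r _ 2) ?nnegrE ?rnorm_ge0 ?(ltW e0) //.
  have h1 : (2^-1)%:C + (2^-1)%:C = 1 :> R[i].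
    by rewrite -rmorphD -(rmorph1 (real_complex R)); congr (_%:C); lra.
  have h2 : x = (2^-1)%:C *: (x + y) + (2^-1)%:C *: (x - y).
    by rewrite -scalerDr addrACA subrr addr0 scalerDr -scalerDl h1 scale1r.
  have h3 : y = (2^-1)%:C *: (x + y) + - ((2^-1)%:C *: (x - y)).
    rewrite -scalerBr opprB [x + y]addrC addrACA addrN addr0.
    by rewrite scalerDr -scalerDl h1 scale1r.
  move: Jx Jy; rewrite {1}h2 [in J y]h3 !JD (rnormN) ripNr fN rnormZ.
  have := Jm ((2^-1)%:C *: (x + y)); rewrite -/m exprMn ger0_norm //.
  by lra.
have Fz : F --> lim F by apply: cauchy_cvg.
set z := lim F in Fz.
have Jz : J z <= m.
  apply/ler_addgt0Pr => e e0.
  (* Lower semicontinuity at z: J z <= J x + c |x - z|. The summand 1 keeps c positive, and [K]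
     enters by its absolute value since its sign is not given. *)
  pose c := 2 * (rnorm z + `|K|) + 1.
  have c0 : 0 < c by rewrite ltr_wpDl // mulr_ge0 // addr_ge0 // rnorm_ge0.
  pose d := e / 2 / c.
  have d0 : 0 < d by rewrite !divr_gt0.
  have nz : F [set x | `|z - x| < d%:C].
    by move: Fz => /fcvgrPdist_lt/(_ d%:C); apply; rewrite ltcR.
  have e20 : 0 < e / 2 by rewrite divr_gt0.
  have nJ : F [set x | J x < m + e / 2] by exists (e / 2).
  have [x [/= zx Jx]] := filter_ex (filterI nz nJ).
  move: zx; rewrite rnormE ltcR => zx.
  have := JD z (x - z); rewrite addrC subrK => Jxz.
  have h1 := rip_CauchySchwarz hip z (x - z).
  have h2 := fK (x - z).
  have zx' : rnorm (x - z) < d by rewrite -rnormN opprB.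
  have : c * rnorm (x - z) <= e / 2.
    by rewrite mulrC -ler_pdivlMr // ltW.
  move: h1 h2; rewrite !ler_norml => /andP[h1 _] /andP[_ h2].
  have h4 : K * rnorm (x - z) <= `|K| * rnorm (x - z).
    by rewrite ler_wpM2r ?rnorm_ge0 // ler_norm.
  have := rnorm_ge0 (x - z); have := sqr_ge0 (rnorm (x - z)).
  by rewrite /c; nra.
exists z => y; apply/eqP; rewrite -subr_eq0 (ripC ip y).
set c := f y - rip ip z y.
pose s := rnorm y ^+ 2.
have s0 : 0 <= s by apply: sqr_ge0.
(* Minimality of z against z + t y gives 0 <= -2 t c + t^2 s = - t^2 (s + 2), hence t = 0 and c = 0.
   The 1 in the denominator covers y = 0. *)
pose t := c / (s + 1).
have := le_trans Jz (Jm (z + t%:C *: y)).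
rewrite JD ripZr fZ rnormZ exprMn -normrX ger0_norm ?sqr_ge0 // -/s => h.
have ct : c = t * (s + 1) by rewrite /t divfK // gt_eqF // ltr_wpDl.
have : t ^+ 2 <= 0.
  have : 0 <= - 2 * t * c + t ^+ 2 * s by rewrite /c; move: h; lra.
  rewrite ct; nra.
rewrite le_eqVlt sqrf_eq0 ltNge sqr_ge0 orbF => /eqP t0.
by rewrite ct t0 mul0r.
Qed.

Lemma bounded_linear_rnorm (R : realType) (V W : normedModType R[i])
    (f : {linear V -> W}) :
  continuous f -> exists2 K : R, 0 < K & forall x, rnorm (f x) <= K * rnorm x.
Proof.
move=> /linear_bounded_continuous/linear_boundedP/pinfty_ex_gt0[M M0 fM].
have ME : M = (complex.Re M)%:C by rewrite RRe_real // gtr0_real.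
exists (complex.Re M); first by rewrite -ltcR -ME.
by move=> x; rewrite -lecR rmorphM /= -ME -!rnormE.
Qed.

Lemma rnorm_bounded_continuous (R : realType) (V W : normedModType R[i])
    (f : {linear V -> W}) (K : R) :
  (forall x, rnorm (f x) <= K * rnorm x) -> continuous f.
Proof.
move=> fK; apply/linear_bounded_continuous/linear_boundedP.
exists K%:C; split; first by apply/complex_realP; exists K.
move=> M KM x; apply: (@le_trans _ _ (K%:C * `|x|)).
  by rewrite !rnormE -rmorphM lecR.
by rewrite ler_wpM2r // ltW.
Qed.

(** P y represents the real functional r(., y). Additivity in y comes from uniqueness, complex
    homogeneity from the conjugate scalar rule for r, and the bound from |P y|^2 = r(P y, y). *)
Lemma form_operator (R : realType) (X : completeNormedModType R[i])
    (ip : {dot X for Num.conj}) (hip : inner_product ip)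
    (r : X -> X -> R) (K : R) :
  (forall x y z, r (x + y) z = r x z + r y z) ->
  (forall x y z, r x (y + z) = r x y + r x z) ->
  (forall (a : R) x y, r (a%:C *: x) y = a * r x y) ->
  (forall (a : R[i]) x y, r (a *: x) y = r x (conjc a *: y)) ->
  (forall x y, `|r x y| <= K * rnorm x * rnorm y) ->
  exists P : {linear X -> X},
    (forall x y, rip ip x (P y) = r x y) /\
    (forall y, rnorm (P y) <= `|K| * rnorm y).
Proof.
move=> rDl rDr rZ rJ rK.
have /choice[P hP] : forall y, exists z, forall x, r x y = rip ip x z.
  move=> y; apply: (riesz_representation hip (K := K * rnorm y)) => //.
  by move=> x; rewrite mulrAC.
have Plin : linear P.
  move=> a y z; apply: (rip_inj hip) => x.
  rewrite -hP rDr ripDr -hP; congr (_ + _).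
  by rewrite -{1}(conjcK a) -rJ hP rip_adjZ conjcK.
pose L := GRing.isLinear.Build _ _ _ _ P Plin.
pose PL : {linear X -> X} := HB.pack P L.
exists PL; split=> [x y|y] /=; first by rewrite -hP.
have [Py0|Py0] := eqVneq (rnorm (P y)) 0.
  by rewrite Py0 mulr_ge0 ?rnorm_ge0.
have Pyp : 0 < rnorm (P y) by rewrite lt_def Py0 rnorm_ge0.
rewrite -(ler_pM2l Pyp) -expr2 (rnorm2 hip) -hP.
apply: (le_trans (ler_norm _)); apply: (le_trans (rK _ _)).
rewrite mulrCA -mulrA ler_wpM2r ?ler_norm //.
by rewrite mulr_ge0 ?rnorm_ge0.
Qed.

(** Riesz shows that the set from which [adjoint] chooses is nonempty. It matches real parts only;
    testing with i y as well matches the imaginary parts. *)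
Lemma adjointP (R : realType) (X Y : completeNormedModType R[i])
    (ipX : {dot X for Num.conj}) (ipY : {dot Y for Num.conj})
    (hX : inner_product ipX) (hY : inner_product ipY)
    (T : {linear X -> Y}) : continuous T ->
  forall x y, ipY (T x) y = ipX x (adjoint ipX ipY T y).
Proof.
move=> /bounded_linear_rnorm[K K0 TK] + y.
have [z hz] : exists z, forall x, rip ipY (T x) y = rip ipX x z.
  apply: (riesz_representation hX (K := K * rnorm y)).
  - by move=> u v; rewrite linearD ripDl.
  - by move=> a u; rewrite linearZ ripZl.
  - move=> x; apply: (le_trans (rip_CauchySchwarz hY _ _)).
    by rewrite mulrAC ler_wpM2r ?rnorm_ge0.
apply: (@xgetPex _ 0 [set z | forall x, ipY (T x) y = ipX x z]).
have hzJ (a : R[i]) x : rip ipY (T x) (a *: y) = rip ipX x (a *: z).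
  by rewrite -{1}(conjcK a) -rip_adjZ -linearZ hz rip_adjZ conjcK.
by exists z => x /=; rewrite !ip_rip hz hzJ.
Qed.

(** * Limits along ultrafilters and dyadic step sizes *)

(** Compactness of [-K, K] gives a cluster point of the image, and a cluster point of an ultrafilter
    is a limit. *)
Lemma bounded_ultrafilter_cvg (R : realType) (G : set_system nat)
    (u : nat -> R) (K : R) :
  UltraFilter G -> (forall n, `|u n| <= K) -> cvg (u @ G).
Proof.
move=> GU uK.
have uI : (u @ G) [set` `[- K, K]].
  apply: (@filterS _ G _ setT (u @^-1` _)); last exact: filterT.
  by move=> n _; have := uK n; rewrite ler_norml /= in_itv.
have [p [_ pc]] := @segment_compact R (- K) K (u @ G) _ uI.
apply/cvg_ex; exists p => B Bp.
have [//|GB] := in_ultra_setVsetC (u @^-1` B) GU.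
by have [x []] := pc (~` B) B GB Bp.
Qed.

Lemma cvg_dist_squeeze (R : realType) (f g : nat -> R) (l : R) :
  (forall k, `|l - f k| <= g k) -> g @ \oo --> (0 : R) -> f @ \oo --> l.
Proof.
move=> fg g0; apply/cvgrPdist_lt => e e0.
move/cvgrPdist_lt: g0 => /(_ _ e0); apply: filterS => k.
by rewrite sub0r normrN; apply: le_lt_trans; apply: le_trans (ler_norm _).
Qed.

Definition dyadic {R : realType} (k : nat) : R := 2^-1 ^+ k.

Lemma dyadic_gt0 (R : realType) k : 0 < dyadic k :> R.
Proof. by rewrite exprn_gt0. Qed.

Lemma dyadic_le1 (R : realType) k : dyadic k <= 1 :> R.
Proof. by rewrite exprn_ile1 // invf_le1 // ler1n. Qed.

Lemma dyadic_cvg0 (R : realType) : (@dyadic R) @ \oo --> (0 : R).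
Proof. by apply: cvg_expr; rewrite ger0_norm // invf_lt1 // ltr1n. Qed.

Lemma dyadic_cvg0_right (R : realType) : (@dyadic R) @ \oo --> (0 : R)^'+.
Proof.
move=> B /= B0.
have : \forall k \near \oo, 0 < dyadic k :> R -> B (dyadic k).
  exact: (@dyadic_cvg0 R) B0.
by apply: filterS => k; apply; exact: dyadic_gt0.
Qed.

(** With 4^k steps of length 2^-k the sums reach time 2^k: the mesh tends to 0 while the horizon
    tends to infinity. *)
Lemma natr4X_dyadic (R : realType) k : (4 ^ k)%:R * dyadic k = 2 ^+ k :> R.
Proof. by rewrite natrX -exprMn; congr (_ ^+ _); lra. Qed.

(** * Riemann sums of the Lyapunov form of a stable semigroup *)

Section LyapunovForm.
Context (R : realType) (X : normedModType R[i]) (ip : {dot X for Num.conj}).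
Hypothesis hip : inner_product ip.
Context (S : R -> X -> X) (M w : R).
Hypotheses (SS : C0_semigroup setT S) (M1 : 1 <= M) (w0 : 0 < w).
Hypothesis SM : forall t x, 0 <= t ->
  rnorm (S t x) <= M * expR (- (w * t)) * rnorm x.

Let SD t x y : 0 <= t -> S t (x + y) = S t x + S t y.
Proof. by case: SS => _ /(_ t 1 x y) + _ _ _ t0; rewrite !scale1r => ->. Qed.

Let SZ t (a : R[i]) x : 0 <= t -> S t (a *: x) = a *: S t x.
Proof.
move=> t0; have S0 : S t 0 = 0 by apply: (addrI (S t 0)); rewrite -SD // !addr0.
case: SS => _ /(_ t a x 0) + _ _ _; rewrite !addr0 S0 addr0; exact.
Qed.

Let S0 x : S 0 x = x.
Proof. by case: SS => _ _ _ [+ _] _; exact. Qed.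

Let Sadd s t x : 0 <= s -> 0 <= t -> S (s + t) x = S s (S t x).
Proof. by case: SS => _ _ _ [_ +] _ s0 t0; exact. Qed.

(** Left Riemann sum of the real part of <S(t) x, S(t) y> over [0, N h]. *)
Definition lyap_sum (h : R) (N : nat) (x y : X) : R :=
  h * \sum_(n < N) rip ip (S (n%:R * h) x) (S (n%:R * h) y).

Let nh_ge0 (n : nat) (h : R) : 0 <= h -> 0 <= n%:R * h.
Proof. by move=> h0; rewrite mulr_ge0. Qed.

Lemma lyap_sumDl h N x y z : 0 <= h ->
  lyap_sum h N (x + y) z = lyap_sum h N x z + lyap_sum h N y z.
Proof.
move=> h0; rewrite /lyap_sum -mulrDr -big_split /=; congr (_ * _).
by apply: eq_bigr => n _; rewrite SD ?ripDl // nh_ge0.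
Qed.

Lemma lyap_sumC h N x y : lyap_sum h N x y = lyap_sum h N y x.
Proof. by rewrite /lyap_sum; congr (_ * _); apply: eq_bigr => n _; rewrite ripC. Qed.

Lemma lyap_sumZl h N (a : R) x y : 0 <= h ->
  lyap_sum h N (a%:C *: x) y = a * lyap_sum h N x y.
Proof.
move=> h0; rewrite /lyap_sum mulrCA; congr (_ * _); rewrite mulr_sumr.
by apply: eq_bigr => n _; rewrite SZ ?ripZl // nh_ge0.
Qed.

Lemma lyap_sum_adjZ h N (a : R[i]) x y : 0 <= h ->
  lyap_sum h N (a *: x) y = lyap_sum h N x (conjc a *: y).
Proof.
move=> h0; rewrite /lyap_sum; congr (_ * _); apply: eq_bigr => n _.
by rewrite !SZ ?rip_adjZ // nh_ge0.
Qed.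

Lemma lyap_sumDr h N x y z : 0 <= h ->
  lyap_sum h N x (y + z) = lyap_sum h N x y + lyap_sum h N x z.
Proof. by move=> h0; rewrite !(lyap_sumC h N x) lyap_sumDl. Qed.

Lemma lyap_sumZr h N (a : R) x y : 0 <= h ->
  lyap_sum h N x (a%:C *: y) = a * lyap_sum h N x y.
Proof. by move=> h0; rewrite !(lyap_sumC h N x) lyap_sumZl. Qed.

Lemma lyap_sumNr h N x y : 0 <= h ->
  lyap_sum h N x (- y) = - lyap_sum h N x y.
Proof.
move=> h0; have := lyap_sumZr N (-1) x y h0.
by rewrite rmorphN1 scaleN1r mulN1r.
Qed.

(** Bounds the form of every sum with step h <= 1, uniformly in h and N. *)
Definition lyap_const : R := M ^+ 2 * ((1 + 2 * w) / (2 * w)).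

(** With q = exp(-2 w h), the sum s satisfies (1 - q) s <= 1, and q (1 + 2 w h) <= 1 together with h
    <= 1 gives 2 w h <= (1 + 2 w)(1 - q). No division by 1 - q occurs, so h = 0 is allowed. *)
Lemma geometric_sum_bound h N : 0 <= h <= 1 ->
  h * \sum_(n < N) expR (- (2 * w * h)) ^+ n <= (1 + 2 * w) / (2 * w).
Proof.
move=> /andP[h0 h1]; set q := expR _; set s := \sum_(_ < _) _.
have q0 : 0 < q by apply: expR_gt0.
have s0 : 0 <= s by apply: sumr_ge0 => n _; rewrite exprn_ge0 // ltW.
have qs : (1 - q) * s <= 1.
  have -> : (1 - q) * s = 1 - q ^+ N by rewrite -opprB mulNr -subrX1 opprB.
  by rewrite lerBlDr lerDl exprn_ge0 // ltW.
have qa : q * (1 + 2 * w * h) <= 1.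
  have := expR_ge1Dx (2 * w * h); rewrite -(ler_pM2l q0) => /le_trans; apply.
  by rewrite /q expRN mulVf // gt_eqF ?expR_gt0.
rewrite ler_pdivlMr ?mulr_gt0 //.
have hq : h * (2 * w) <= (1 + 2 * w) * (1 - q).
  have q1 : q <= 1 by rewrite -expR0 ler_expR oppr_le0 !mulr_ge0 // ltW.
  have : 0 <= (1 - q) * (w * (1 - h)).
    by rewrite !mulr_ge0 ?subr_ge0 // ltW.
  move: qa; lra.
rewrite mulrAC; apply: (le_trans (ler_wpM2r s0 hq)).
by rewrite -mulrA ler_piMr // addr_ge0 // mulr_ge0 // ltW.
Qed.

Lemma lyap_sum_bound h N x y : 0 <= h <= 1 ->
  `|lyap_sum h N x y| <= lyap_const * rnorm x * rnorm y.
Proof.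
move=> h01; have h0 : 0 <= h by case/andP: h01.
rewrite normrM (ger0_norm h0).
have H : `|\sum_(n < N) rip ip (S (n%:R * h) x) (S (n%:R * h) y)| <=
    \sum_(n < N) M ^+ 2 * rnorm x * rnorm y * expR (- (2 * w * h)) ^+ n.
  apply: (le_trans (ler_norm_sum _ _ _)); apply: ler_sum => n _.
  apply: (le_trans (rip_CauchySchwarz hip _ _)).
  apply: (le_trans (ler_pM _ _ (SM _ _) (SM _ _))); rewrite ?rnorm_ge0 ?nh_ge0 //.
  have -> : expR (- (2 * w * h)) ^+ n = expR (- (w * (n%:R * h))) ^+ 2.
    by rewrite -!expRM_natl; congr expR; ring.
  by rewrite le_eqVlt; apply/orP; left; apply/eqP; ring.
apply: (le_trans (ler_wpM2l h0 H)); rewrite -mulr_sumr mulrCA.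
have := geometric_sum_bound N h01; set s := h * _ => hs.
have K0 : 0 <= M ^+ 2 * rnorm x * rnorm y.
  by rewrite -mulrA mulr_ge0 ?sqr_ge0 ?mulr_ge0 ?rnorm_ge0.
apply: (le_trans (ler_wpM2l K0 hs)); rewrite /lyap_const le_eqVlt.
by apply/orP; left; apply/eqP; ring.
Qed.

(* Shifting the sum by one step telescopes: this is the discrete Lyapunov
   equation. *)
Lemma lyap_sum_shift h N x : 0 <= h ->
  lyap_sum h N (S h x) (S h x) =
  lyap_sum h N x x + h * (rnorm (S (N%:R * h) x) ^+ 2 - rnorm x ^+ 2).
Proof.
move=> h0; rewrite /lyap_sum -mulrDr; congr (_ * _).
elim: N => [|N IH]; first by rewrite !big_ord0 mul0r S0 subrr addr0.
rewrite !big_ord_recr /= IH -Sadd ?nh_ge0 // -!rnorm2 //.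
have -> : N%:R * h + h = N.+1%:R * h by rewrite -natr1 mulrDl mul1r.
ring.
Qed.

Local Notation lyapk k := (lyap_sum (dyadic k) (4 ^ k)).
Let dy01 k : 0 <= @dyadic R k <= 1.
Proof. by rewrite dyadic_le1 ltW // dyadic_gt0. Qed.
Let dy0 k : 0 <= dyadic k :> R.
Proof. by rewrite ltW // dyadic_gt0. Qed.

Lemma difference_quotient_cvg D A x : generated_by setT S D A -> D x ->
  rnorm (A x - (dyadic k)^-1%:C *: (S (dyadic k) x - x)) @[k --> \oo] --> (0 : R).
Proof.
move=> /(_ x (A x) I)[+ _] Dx => /(_ (conj Dx erefl)) h.
apply/cvgrPdist_lt => e e0.
have /fcvgrPdist_lt/(_ e%:C) := cvg_comp _ _ (@dyadic_cvg0_right R) h.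
rewrite ltcR => /(_ e0)[N _ hN]; exists N => // k /hN /=.
by rewrite sub0r normrN rnormE ltcR ger0_norm ?rnorm_ge0 // fmorphV.
Qed.

(** Inserting S(h) x = x + h d into the shift identity and dividing by h leaves 2 l(x, d) + h l(d,
    d) = |S(2^k) x|^2 - |x|^2, where the difference quotient d tends to A x. *)
Lemma lyap_sum_generator D A x : generated_by setT S D A -> D x ->
  2 * lyapk k x (A x) @[k --> \oo] --> - rnorm x ^+ 2.
Proof.
move=> gS Dx; set y := A x.
pose d k := (dyadic k)^-1%:C *: (S (dyadic k) x - x).
pose e k := rnorm (y - d k).
have e0 : e @ \oo --> (0 : R) by exact: difference_quotient_cvg gS Dx.
pose K := lyap_const.
have K0 : 0 <= K.
  by rewrite mulr_ge0 ?sqr_ge0 // divr_ge0 ?addr_ge0 ?mulr_ge0 // ltW.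
(* The three errors: the tail |S(2^k) x|^2, the quadratic term h l(d, d), and the replacement of d
   by A x. *)
pose g k := (M * (dyadic k / w) * rnorm x) ^+ 2
  + dyadic k * (K * (rnorm y + e k) ^+ 2) + 2 * (K * rnorm x * e k).
apply: (@cvg_dist_squeeze _ _ g); last first.
  (* Zero is written in the shape of [g], so that the limit rules for sums and products apply term
     by term. *)
  have -> : 0 = (M * (0 / w) * rnorm x) * (M * (0 / w) * rnorm x)
     + 0 * (K * ((rnorm y + 0) * (rnorm y + 0))) + 2 * (K * rnorm x * 0) :> R.
    by ring.
  have dw : M * (dyadic k / w) * rnorm x @[k --> \oo] --> M * (0 / w) * rnorm x.
    apply: cvgM; last exact: cvg_cst.
    apply: cvgM; first exact: cvg_cst.
    by apply: cvgM; [exact: dyadic_cvg0|exact: cvg_cst].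
  have ye : rnorm y + e k @[k --> \oo] --> rnorm y + 0.
    by apply: cvgD => //; exact: cvg_cst.
  apply: cvgD; last first.
    by apply: cvgM; [exact: cvg_cst|apply: cvgM => //; exact: cvg_cst].
  apply: cvgD; first by apply: cvgM.
  apply: cvgM; first exact: dyadic_cvg0.
  by apply: cvgM; [exact: cvg_cst|exact: cvgM].
move=> k; rewrite /g.
have h0 := dyadic_gt0 R k; have h1 := dy0 k; set h := dyadic k in h0 h1 *.
have Shx : S h x = x + h%:C *: d k.
  by rewrite /d scalerA -rmorphM /= divff ?gt_eqF // scale1r addrC subrK.
(* An opaque copy of [d k], whose body itself contains [S h x]. *)
have [dk dkE] : {dk | d k = dk} by exists (d k).
have ekE : e k = rnorm (y - dk) by rewrite /e dkE.
rewrite dkE in Shx.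
have := lyap_sum_shift (4 ^ k) x h1.
rewrite natr4X_dyadic -/h Shx lyap_sumDl // !lyap_sumDr // !lyap_sumZl //.
rewrite !lyap_sumZr //. rewrite (lyap_sumC h _ dk x).
have dye : dk = y + - (y - dk) by rewrite opprB addrC subrK.
have Ld : lyap_sum h (4 ^ k) x dk = lyapk k x y - lyap_sum h (4 ^ k) x (y - dk).
  by rewrite {1}dye lyap_sumDr // lyap_sumNr.
rewrite Ld => E.
have {}E : 2 * lyapk k x y = rnorm (S (2 ^+ k) x) ^+ 2 - rnorm x ^+ 2
   + 2 * lyap_sum h (4 ^ k) x (y - dk) - h * lyap_sum h (4 ^ k) dk dk.
  apply: (mulfI (lt0r_neq0 h0)); move: E; lra.
(* From 1 + s <= exp s at s = w 2^k: exp(-w 2^k) <= 1 / (w 2^k) = h / w. *)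
have b1 : rnorm (S (2 ^+ k) x) <= M * (h / w) * rnorm x.
  apply: (le_trans (SM _ _)); first by rewrite exprn_ge0.
  rewrite ler_wpM2r ?rnorm_ge0 // ler_wpM2l ?(le_trans ler01) //.
  rewrite expRN ler_pdivlMr // mulrC ler_pdivrMr ?expR_gt0 //.
  have hk : h * 2 ^+ k = 1 by rewrite /h /dyadic -exprMn mulVf // expr1n.
  have : h * (1 + w * 2 ^+ k) <= h * expR (w * 2 ^+ k).
    by rewrite ler_wpM2l // expR_ge1Dx.
  apply: le_trans; rewrite mulrDr mulr1 mulrCA hk mulr1 lerDr //.
have b2 : rnorm (S (2 ^+ k) x) ^+ 2 <= (M * (h / w) * rnorm x) ^+ 2.
  by rewrite ler_sqr ?nnegrE ?rnorm_ge0 // (le_trans (rnorm_ge0 _) b1).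
have := lyap_sum_bound (4 ^ k) x (y - dk) (dy01 k).
have := lyap_sum_bound (4 ^ k) dk dk (dy01 k).
rewrite -/h -/K -ekE.
have dke : rnorm dk <= rnorm y + e k.
  by rewrite {1}dye ekE (le_trans (rnorm_triangle _ _)) // rnormN.
set l1 := lyap_sum _ _ dk _; set l2 := lyap_sum _ _ x (y - dk).
move=> B1 B2.
have {}B1 : `|h * l1| <= h * (K * (rnorm y + e k) ^+ 2).
  rewrite normrM ger0_norm // ler_wpM2l //; apply: (le_trans B1).
  rewrite -mulrA ler_wpM2l // -expr2 ler_sqr // nnegrE ?rnorm_ge0 //.
  by rewrite addr_ge0 ?rnorm_ge0.
rewrite E -/l1 -/l2.
have -> : - rnorm x ^+ 2 -
    (rnorm (S (2 ^+ k) x) ^+ 2 - rnorm x ^+ 2 + 2 * l2 - h * l1) = - rnorm (S (2 ^+ k) x) ^+ 2 + h * l1 + - (2 * l2) by ring.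
apply: (le_trans (ler_normD _ _)); apply: lerD; last first.
  by rewrite normrN normrM ger0_norm // ler_wpM2l.
apply: (le_trans (ler_normD _ _)); apply: lerD => //.
by rewrite normrN ger0_norm ?sqr_ge0.
Qed.

(** Strong continuity keeps |S(t) x| >= |x| / 2 on some [0, 2^-p). The terms from this interval
    alone contribute 2^-p (|x| / 2)^2, whatever k >= p is. *)
Lemma lyap_sum_lower x : x != 0 ->
  exists2 d, 0 < d & \forall k \near \oo, d <= lyapk k x x.
Proof.
move=> x0; have nx := rnorm_gt0 x0.
have Sx : S t x @[t --> 0^'+] --> x by case: SS => _ _ _ _; exact.
have [p hp] : exists p, forall t, 0 <= t < dyadic p ->
    rnorm x / 2 <= rnorm (S t x).
  have e0 : 0 < (rnorm x / 2)%:C by rewrite ltcR divr_gt0.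
  have /fcvgrPdist_lt/(_ _ e0) := Sx.
  move=> /nbhs_ballP[e /= ep he].
  have /cvgrPdist_lt/(_ _ ep) := @dyadic_cvg0 R.
  case=> p _ /(_ p (leqnn p)) /=; rewrite sub0r normrN ger0_norm // => pe.
  (* The right-hand limit says nothing at t = 0, where S(0) x = x is used instead. *)
  exists p => t /andP[]; rewrite le_eqVlt => /predU1P[<- _|t0 tp].
    by rewrite S0; lra.
  have := he t; rewrite -ball_normE /= sub0r normrN gtr0_norm // (lt_trans tp pe).
  move=> /(_ isT t0); rewrite rnormE ltcR => h.
  have := rnorm_triangle (x - S t x) (S t x); rewrite subrK; lra.
exists (dyadic p * (rnorm x / 2) ^+ 2).
  by rewrite mulr_gt0 ?dyadic_gt0 // exprn_gt0 // divr_gt0.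
exists p => // k /= pk; rewrite /lyap_sum.
(* The first 2^(k - p) steps of length 2^-k fill [0, 2^-p), and the sum has at least that many
   terms. *)
have kp : (2 ^ (k - p) <= 4 ^ k)%N.
  rewrite (leq_trans (leq_pexp2l _ (leq_subr p k))) //.
  by rewrite (expnMn 2 2) leq_pmulr ?expn_gt0.
have dkp : (2 ^ (k - p))%:R * dyadic k = dyadic p :> R.
  rewrite /dyadic -{2}(subnK pk) exprD mulrA natrX -exprMn mulfV ?pnatr_eq0 //.
  by rewrite expr1n mul1r.
rewrite -(big_mkord xpredT
  (fun n => rip ip (S (n%:R * dyadic k) x) (S (n%:R * dyadic k) x))).
rewrite (big_cat_nat (n := (2 ^ (k - p))%N)) //= mulrDr.
rewrite ler_wpDr //.
  by rewrite mulr_ge0 // sumr_ge0 // => n _; rewrite -rnorm2 // sqr_ge0.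
rewrite -dkp -mulrA mulrCA ler_wpM2l // mulrC mulr_natr.
have -> : (rnorm x / 2) ^+ 2 *+ 2 ^ (k - p) =
    \sum_(0 <= n < 2 ^ (k - p)) (rnorm x / 2) ^+ 2.
  by rewrite sumr_const_nat subn0.
apply: ler_sum_nat => n /andP[_ nk].
rewrite -rnorm2 // ler_sqr ?nnegrE ?rnorm_ge0 ?divr_ge0 ?rnorm_ge0 //.
by apply: hp; rewrite nh_ge0 //= -dkp ltr_pM2r ?dyadic_gt0 // ltr_nat.
Qed.

End LyapunovForm.

(** * The Lyapunov operator of an exponentially stable generator *)

Lemma self_adjoint_real (R : realType) (X : normedModType R[i])
    (ip : {dot X for Num.conj}) (P : X -> X) :
  self_adjoint ip P -> forall x, ip (P x) x = (rip ip (P x) x)%:C.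
Proof.
move=> sP x; have := hermC ip (P x) x; rewrite expr0 mul1r /= conjCE -sP.
rewrite /rip; case: (ip (P x) x) => a b /= [/eqP]; rewrite -addr_eq0 => b0.
by congr (_ +i* _); apply/eqP; move: b0; rewrite -mulr2n mulrn_eq0.
Qed.

Lemma lyapunov_operator (R : realType) (X : completeNormedModType R[i])
    (ip : {dot X for Num.conj}) (hip : inner_product ip)
    (D : set X) (B : X -> X) :
  generates_exp_stable setT D B ->
  exists P : {linear X -> X}, [/\ continuous P, self_adjoint ip P,
    positive_op ip P &
    forall x, D x -> 2 * rip ip (P x) (B x) = - rnorm x ^+ 2].
Proof.
move=> [S [SS gS [M [w [M1 w0 SM']]]]].
have SM t x : 0 <= t -> rnorm (S t x) <= M * expR (- (w * t)) * rnorm x.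
  by move=> t0; rewrite -lecR rmorphM /= -!rnormE SM'.
have dy0 k : 0 <= dyadic k :> R by rewrite ltW // dyadic_gt0.
pose l k := lyap_sum ip S (dyadic k) (4 ^ k).
(* Refining [\oo] keeps eventual bounds and ordinary limits valid, while every bounded sequence now
   converges. *)
have [G [GU oG]] := @ultraFilterLemma nat \oo _.
have lb x y k : `|l k x y| <= lyap_const M w * rnorm x * rnorm y.
  by apply: lyap_sum_bound; rewrite ?dy0 ?dyadic_le1.
have lc x y : cvg (l k x y @[k --> G]).
  exact: (bounded_ultrafilter_cvg (K := lyap_const M w * rnorm x * rnorm y)).
pose r x y := lim (l k x y @[k --> G]).
have eq_limG (u v : nat -> R) : u =1 v -> lim (u @ G) = lim (v @ G).
  by move=> /funext ->.
have limG_scale (a : R) (u : nat -> R) :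
    cvg (u @ G) -> lim (a * u k @[k --> G]) = a * lim (u @ G).
  by move=> cu; apply/cvg_lim => //; apply: cvgM => //; exact: cvg_cst.
have rC x y : r x y = r y x.
  by rewrite /r; apply: eq_limG => k; exact: lyap_sumC.
have rDl x y z : r (x + y) z = r x z + r y z.
  rewrite /r -limD //; apply: eq_limG => k.
  exact: lyap_sumDl.
have rZ (a : R) x y : r (a%:C *: x) y = a * r x y.
  rewrite /r -limG_scale //; apply: eq_limG => k.
  exact: lyap_sumZl.
have rJ (a : R[i]) x y : r (a *: x) y = r x (conjc a *: y).
  rewrite /r; apply: eq_limG => k; exact: lyap_sum_adjZ.
have rb x y : `|r x y| <= lyap_const M w * rnorm x * rnorm y.
  rewrite ler_norml; apply/andP; split.
    apply: limr_ge => //; apply: nearW => k.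
    by have := lb x y k; rewrite ler_norml => /andP[].
  apply: limr_le => //; apply: nearW => k.
  by have := lb x y k; rewrite ler_norml => /andP[].
have [||||//|P [rP Pb]] := form_operator hip (r := r) (K := lyap_const M w).
- by [].
- by move=> x y z; rewrite !(rC x).
- by [].
- by [].
have sP : self_adjoint ip P.
  move=> x y; rewrite !ip_rip -linearZ /=.
  by congr (_ +i* _); rewrite ripC !rP rC.
exists P; split => //.
- exact: rnorm_bounded_continuous Pb.
- move=> x x0; rewrite self_adjoint_real // ltcR ripC rP.
  (* A lower bound independent of k keeps the inequality strict in the limit. *)
  have [d d0 dl] := lyap_sum_lower hip SS x0.
  by apply: (lt_le_trans d0); apply: limr_ge => //; exact: oG.
move=> x Dx; rewrite ripC rP rC -limG_scale //.
apply: cvg_lim => //; apply: cvg_trans (lyap_sum_generator hip SS M1 w0 SM gS Dx).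
by move=> U /= /oG.
Qed.

(** * The strict Lyapunov inequality from detectability *)

Theorem theorem6 (R : realType) (X Y : completeNormedModType R[i])
  (ipX : {dot X for Num.conj}) (ipY : {dot Y for Num.conj})
  (hX : inner_product ipX) (hY : inner_product ipY)
  (D : set X) (A : X -> X)
  (linA : linear_operator D A) (closedA : closed_operator D A)
  (denseA : densely_defined D) (genA : generates_semigroup setT D A)
  (C : {linear X -> Y}) (contC : continuous C)
  (Gamma : R -> R[i]^o) (sdaA : spectral_decomposition D A Gamma)
  (As_stable : generates_exp_stable (stable_space D A Gamma)
                 (D `&` stable_space D A Gamma) A)
  (fin_plus : finite_set (spectrum_plus D A))
  (fin_order : forall a, spectrum_plus D A a -> eigenvalue_of_finite_order D A a)
  (orth : forall xu xs, unstable_space D A Gamma xu ->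
            stable_space D A Gamma xs -> ipX xu xs = 0)
  (detect : exp_detectable D A C) :
  let Q := fun x => adjoint ipX ipY C (C x) in
  exists (P : {linear X -> X}) (m : R),
    [/\ continuous P, self_adjoint ipX P, positive_op ipX P, 0 < m &
        forall x, D x ->
          m%:C * `|x| ^+ 2 <= ipX (Q x) x - ipX (P x) (A x) - ipX (P (A x)) x].
Proof.
move=> Q; case: detect => L [contL stabL].
have [P [contP sP pP lyapP]] := lyapunov_operator hX stabL.
have [K K0 PK] := bounded_linear_rnorm contP.
have [l l0 Ll] := bounded_linear_rnorm contL.
pose c := K * l; have c0 : 0 < c by rewrite mulr_gt0.
(* This scaling turns the loss 2 c^2 |C x|^2 into exactly <Q x, x> = |C x|^2; the surplus |x|^2 / 2
   becomes (b / 2) |x|^2, whence m = b / 2. *)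
pose b : R := (2 * c ^+ 2)^-1.
have b0 : 0 < b by rewrite invr_gt0 mulr_gt0 // exprn_gt0.
have PlinE : linear (fun x => b%:C *: P x).
  by move=> a u v; rewrite linearP scalerDr !scalerA mulrC.
pose PL := GRing.isLinear.Build _ _ _ _ (fun x => b%:C *: P x) PlinE.
pose P' : {linear X -> X} := HB.pack (fun x => b%:C *: P x) PL.
have P'E x : P' x = b%:C *: P x by [].
have sP' : self_adjoint ipX P'.
  move=> x y; rewrite !P'E (linearZl_LR ipX) (linearZr_LR ipX) /= conjCE sP.
  by rewrite conjc_real.
exists P', (b / 2); split=> //.
- apply: (rnorm_bounded_continuous (K := b * K)) => x.
  by rewrite P'E rnormZ gtr0_norm // -mulrA; apply: ler_wpM2l => //; apply: ltW.
- move=> x x0; rewrite P'E (linearZl_LR ipX) /= mulr_gt0 ?ltcR //.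
  exact: pP.
- by rewrite divr_gt0.
move=> x Dx.
have Qx : ipX (Q x) x = (rnorm (C x) ^+ 2)%:C.
  rewrite (hermC ipX) expr0 mul1r /= conjCE /Q -adjointP // hY rnormE.
  by rewrite -rmorphXn conjc_real.
(* By self-adjointness the two cross terms are conjugate, so their sum is real. *)
have PAx : ipX (P' x) (A x) + ipX (P' (A x)) x = (2 * rip ipX (P' x) (A x))%:C.
  rewrite (sP' (A x)) [X in _ + X](hermC ipX) expr0 mul1r /= conjCE addcJ.
  by rewrite rmorphM rmorph_nat.
rewrite -addrA -opprD PAx Qx rnormE -rmorphXn -rmorphM -rmorphB lecR.
have E := lyapP _ Dx; move: E; rewrite ripDr P'E ripZl => E.
have B : `|rip ipX (P x) (L (C x))| <= c * rnorm x * rnorm (C x).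
  apply: (le_trans (rip_CauchySchwarz hX _ _)).
  apply: (le_trans (ler_pM _ _ (PK x) (Ll (C x)))); rewrite ?rnorm_ge0 //.
  by rewrite le_eqVlt; apply/orP; left; apply/eqP; rewrite /c; ring.
move: B; rewrite ler_norml => /andP[B _].
set p := rip ipX (P x) (A x) in E *.
set u := rnorm x in E B *; set v := rnorm (C x) in B *.
have bv : v ^+ 2 = b * (2 * c ^+ 2 * v ^+ 2).
  by rewrite /b mulrA mulVf ?mul1r // gt_eqF // mulr_gt0 // exprn_gt0.
rewrite bv -subr_ge0.
have -> : b * (2 * c ^+ 2 * v ^+ 2) - 2 * (b * p) - b / 2 * u ^+ 2 =
  b * (2 * c ^+ 2 * v ^+ 2 - 2 * p - u ^+ 2 / 2) by ring.
apply: mulr_ge0; first exact: ltW.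
(* Since -2 p >= u^2 - 2 c u v, the bracket is at least (u - 2 c v)^2 / 2. *)
have := sqr_ge0 (u - 2 * (c * v)); move: E B; nra.
Qed.
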